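(* Let $S:\mathbb{R}^n\rightrightarrows\mathbb{R}^m$ be a set-valued mapping, $\bar{x}\in X\subset\mathbb{R}^n$ and $\bar{u}\in S(\bar{x})$. Suppose that $\operatorname{gph}S$ is locally closed at $(\bar{x},\bar{u})$ and that $X$ is closed and convex. The following properties are equivalent: (a) $S$ has the Lipschitz-like property relative to $X$ at $\bar{x}$ for $\bar{u}$. (b) $D^*_XS(\bar{x}\mid\bar{u})(0)=\{0\}$. (c) $|D^*_XS(\bar{x}\mid\bar{u})|^+<+\infty$. Furthermore, $$\operatorname{lip}_XS(\bar{x}\mid\bar{u})=|D^*_XS(\bar{x}\mid\bar{u})|^+.$$
   Context: $\|\cdot\|$ is the Euclidean norm, $\mathbb{B}$ the closed unit ball. A set $A$ is locally closed at $x\in A$ if $A\cap U$ is closed for some closed neighborhood $U$ of $x$. $\operatorname{proj}_A(x)$ is the set of points of $A$ nearest to $x$ (a single point when $A$ is nonempty closed convex). $\operatorname{gph}S=\{(x,u)\mid u\in S(x)\}$. The restricted mapping $S|_X$ is $S|_X(x)=S(x)$ if $x\in X$ and $\emptyset$ otherwise, so $\operatorname{gph}S|_X=\operatorname{gph}S\cap(X\times\mathbb{R}^m)$. Lipschitz-like property relative to $X$ at $\bar x$ for $\bar u$: $\operatorname{gph}S$ is locally closed at $(\bar{x},\bar{u})$ and there are neighborhoods $V$ of $\bar{x}$, $W$ of $\bar{u}$ and a constant $\kappa\ge0$ such that $S(x')\cap W\subset S(x)+\kappa\|x'-x\|\mathbb{B}$ for all $x,x'\in X\cap V$. The graphical modulus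 $\operatorname{lip}_XS(\bar{x}\mid\bar{u})$ is the infimum of all $\kappa\ge0$ for which there exist neighborhoods $V$ of $\bar{x}$ and $W$ of $\bar{u}$ such that this inclusion holds for all $x,x'\in X\cap V$ (with $\inf\emptyset=+\infty$). For $x\in A$: the tangent (contingent) cone $T_A(x)$ consists of all $w$ for which there exist $t_k\downarrow0$, $w_k\to w$ with $x+t_kw_k\in A$ for all $k$; $\widehat{N}_A(x)=\{v\mid\langle v,w\rangle\le0\ \forall w\in T_A(x)\}$; the (limiting) normal cone $N_A(x)$ consists of all $v$ for which there exist $x_k\to x$, $v_k\to v$ with $x_k\in A$, $v_k\in\widehat{N}_A(x_k)$. For $(x,u)\in\operatorname{gph}S|_X$, $x^*\in D^*S|_X(x\mid u)(u^* )\iff(x^*,-u^* )\in N_{\operatorname{gph}S|_X}(x,u)$. The projectional coderivative of $S$ at $\bar{x}$ for $\bar{u}$ with respect to $X$ is the mapping $D^*_XS(\bar{x}\mid\bar{u}):\mathbb{R}^m\rightrightarrows\mathbb{R}^n$ defined as follows: $x^*\in D^*_XS(\bar{x}\mid\bar{u})(u^* )$ if and only if there are sequences $(x_k,u_k)\to(\bar{x},\bar{u})$ with $(x_k,u_k)\in\operatorname{gph}S|_X$, and $x_k^*\in D^*S|_X(x_k\mid u_k)(u_k^* )$, such that $u_k^*\to u^*$ and $\operatorname{proj}_{T_X(x_k)}(x_k^* )\to x^*$. For a positively homogeneous mapping $H$ (i.e. $\operatorname{gph}H$ is a cone containing the origin), the outer norm is $|H|^+=\sup_{y\in\mathbb{B}}\sup_{z\in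 H(y)}\|z\|$ (suprema over empty sets being $0$). *)

(* Defs.v *)
From mathcomp Require Import all_boot all_order all_algebra.
From mathcomp Require Import all_classical all_reals all_analysis.

Set Implicit Arguments.
Unset Strict Implicit.
Unset Printing Implicit Defensive.

Import Order.TTheory GRing.Theory Num.Theory.
Import numFieldNormedType.Exports.

Local Open Scope classical_set_scope.
Local Open Scope ring_scope.

Section Defs.
Context {R : realType}.

(* The library norm on matrices is the sup norm: it gives the same topology as
   the Euclidean norm, which has to be defined separately. *)
Definition dotv d (v w : 'rV[R]_d) : R := \sum_(i < d) v 0 i * w 0 i.
Definition enorm d (v : 'rV[R]_d) : R := Num.sqrt (dotv v v).
Definition unit_eball d : set 'rV[R]_d := [set v | enorm v <= 1].

Definition locally_closed d (A : set 'rV[R]_d) (x : 'rV[R]_d) : Prop :=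
  exists U : set 'rV[R]_d, [/\ nbhs x U, closed U & closed (A `&` U)].

Definition proj d (A : set 'rV[R]_d) (x : 'rV[R]_d) : set 'rV[R]_d :=
  [set p | A p /\ forall a, A a -> enorm (x - p) <= enorm (x - a)].

Definition tangent_cone d (A : set 'rV[R]_d) (x : 'rV[R]_d) : set 'rV[R]_d :=
  [set w | exists (t : nat -> R) (w_ : nat -> 'rV[R]_d),
    [/\ forall k, 0 < t k, t @ \oo --> (0 : R), w_ @ \oo --> w &
        forall k, A (x + t k *: w_ k)]].

Definition regular_normal_cone d (A : set 'rV[R]_d) (x : 'rV[R]_d) :
    set 'rV[R]_d :=
  [set v | forall w, tangent_cone A x w -> dotv v w <= 0].

Definition normal_cone d (A : set 'rV[R]_d) (x : 'rV[R]_d) : set 'rV[R]_d :=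
  [set v | exists x_ v_ : nat -> 'rV[R]_d,
    [/\ x_ @ \oo --> x, v_ @ \oo --> v &
        forall k, A (x_ k) /\ regular_normal_cone A (x_ k) (v_ k)]].

(* R^n x R^m is represented by 'rV[R]_(n + m), a pair (x, u) being row_mx x u:
   this has the product topology, inner product and Euclidean norm. *)
Definition gph n m (S : 'rV[R]_n -> set 'rV[R]_m) : set 'rV[R]_(n + m) :=
  [set z | S (lsubmx z) (rsubmx z)].

Definition restr n m (S : 'rV[R]_n -> set 'rV[R]_m) (X : set 'rV[R]_n) :
    'rV[R]_n -> set 'rV[R]_m :=
  patch (fun=> set0) X S.

Definition coderivative n m (S : 'rV[R]_n -> set 'rV[R]_m)
    (x : 'rV[R]_n) (u : 'rV[R]_m) : 'rV[R]_m -> set 'rV[R]_n :=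
  fun us => [set xs | normal_cone (gph S) (row_mx x u) (row_mx xs (- us))].

(* For closed convex X the tangent cones are nonempty, closed and convex, so
   each p_ k below is the unique projection point. *)
Definition proj_coderivative n m (S : 'rV[R]_n -> set 'rV[R]_m)
    (X : set 'rV[R]_n) (x : 'rV[R]_n) (u : 'rV[R]_m) :
    'rV[R]_m -> set 'rV[R]_n :=
  fun us => [set xs |
    exists (x_ : nat -> 'rV[R]_n) (u_ : nat -> 'rV[R]_m)
           (xs_ : nat -> 'rV[R]_n) (us_ : nat -> 'rV[R]_m)
           (p_ : nat -> 'rV[R]_n),
      [/\ x_ @ \oo --> x /\ u_ @ \oo --> u,
          forall k, gph (restr S X) (row_mx (x_ k) (u_ k)),
          forall k, coderivative (restr S X) (x_ k) (u_ k) (us_ k) (xs_ k),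
          us_ @ \oo --> us &
          (forall k, proj (tangent_cone X (x_ k)) (xs_ k) = [set p_ k]) /\
          p_ @ \oo --> xs]].

Definition lip_inclusion n m (S : 'rV[R]_n -> set 'rV[R]_m)
    (X V : set 'rV[R]_n) (W : set 'rV[R]_m) (kappa : R) : Prop :=
  forall x x', (X `&` V) x -> (X `&` V) x' ->
    S x' `&` W `<=`
      [set a + b | a in S x &
                   b in [set (kappa * enorm (x' - x)) *: e
                        | e in @unit_eball m]].

Definition lipschitz_like n m (S : 'rV[R]_n -> set 'rV[R]_m)
    (X : set 'rV[R]_n) (x : 'rV[R]_n) (u : 'rV[R]_m) : Prop :=
  locally_closed (gph S) (row_mx x u) /\
  exists (V : set 'rV[R]_n) (W : set 'rV[R]_m) (kappa : R),
    [/\ nbhs x V, nbhs u W, 0 <= kappa & lip_inclusion S X V W kappa].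

Definition lip_modulus n m (S : 'rV[R]_n -> set 'rV[R]_m)
    (X : set 'rV[R]_n) (x : 'rV[R]_n) (u : 'rV[R]_m) : \bar R :=
  ereal_inf [set kappa%:E | kappa in [set kappa : R | 0 <= kappa /\
    exists (V : set 'rV[R]_n) (W : set 'rV[R]_m),
      [/\ nbhs x V, nbhs u W & lip_inclusion S X V W kappa]]].

(* ereal_sup set0 is -oo, whereas the outer norm uses the convention 0. *)
Definition sup0 (A : set (\bar R)) : \bar R :=
  if A == set0 then 0%E else ereal_sup A.

Definition outer_norm n m (H : 'rV[R]_m -> set 'rV[R]_n) : \bar R :=
  sup0 [set sup0 [set (enorm z)%:E | z in H y] | y in @unit_eball m].

End Defs.

(* Main.v *)
Require Import Defs.
From mathcomp Require Import all_boot all_order all_algebra.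
From mathcomp Require Import all_classical all_reals all_analysis.
From mathcomp Require Import ring lra.
Import Order.TTheory GRing.Theory Num.Theory.
Import numFieldNormedType.Exports.
Local Open Scope classical_set_scope.
Local Open Scope ring_scope.
Set Implicit Arguments.
Unset Strict Implicit.
Unset Printing Implicit Defensive.

(** Write G for the graph of S restricted to X, and D for the projectional
coderivative. Everything rests on two facts about a constant kappa.

If the Lipschitz inclusion holds with kappa near the reference point, then
[|xs| <= kappa |us|] for every xs in D(us) ([proj_coderivative_bound]).
Indeed let (xs, -us) be a regular normal to G at (x, u) and let y be in X.
Moving x along the segment towards y stays in X, and the inclusion lets u
follow at speed at most kappa |y - x|; a limit of these velocities gives a
tangent vector to G, hence [<xs, y - x> <= kappa |us| |y - x|].
For fixed y in X this inequality is stable under limits, so it passes to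
limiting normals, and then to all w in the tangent cone of X at x.
Taking for w the projection p of xs on that cone, where [|p|^2 <= <xs, p>],
gives [|p| <= kappa |us|], and a last limit gives the claim.

If the inclusion with kappa fails on every neighborhood and a < b kappa, then
some D(us) contains some xs with |xs| = a and |us| <= b
([regular_normal_of_failure], [proj_coderivative_of_normals]).
A failure of the inclusion is given by x, x' in X and u' in S(x') such that no
point of S(x) lies within kappa |x' - x| of u'. Minimise
[a |y - x| + b sqrt (|v - u'|^2 + delta^2)] over the points (y, v) of G near
the reference point, for a well chosen delta. The value at (x', u') is
too small for a minimiser to have y = x, so the function is smooth at the
minimiser, and minus its gradient, (xs, -us), is a regular normal there, with
|xs| = a and |us| <= b. Moreover xs is a positive multiple of x - y, which is
tangent to X at y because X is convex: so xs is its own projection. Compactness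
yields an element of the graph of D in the limit.

The theorem follows. The first fact gives (a) => (b), (a) => (c) and
|D|^+ <= lip. The second one, with b = 1 and |D|^+ < a < kappa < lip, shows
lip <= |D|^+, hence (c) => (a); with a = 1, kappa -> +oo and b -> 0 it shows
that D(0) contains a unit vector as soon as (a) fails. *)

(** * Euclidean structure *)

Lemma dotvC (R : realType) d (v w : 'rV[R]_d) : dotv v w = dotv w v.
Proof. by apply: eq_bigr => i _; rewrite mulrC. Qed.

Lemma dotvDl (R : realType) d (u v w : 'rV[R]_d) :
  dotv (u + v) w = dotv u w + dotv v w.
Proof. by rewrite -big_split; apply: eq_bigr => i _; rewrite mxE mulrDl. Qed.

Lemma dotvZl (R : realType) d (a : R) (v w : 'rV[R]_d) :
  dotv (a *: v) w = a * dotv v w.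
Proof.
by rewrite /dotv big_distrr /=; apply: eq_bigr => i _; rewrite mxE mulrA.
Qed.

Lemma dotv0l (R : realType) d (w : 'rV[R]_d) : dotv 0 w = 0.
Proof. by rewrite -(scale0r 0) dotvZl mul0r. Qed.

Lemma dotvDr (R : realType) d (u v w : 'rV[R]_d) :
  dotv u (v + w) = dotv u v + dotv u w.
Proof. by rewrite dotvC dotvDl !(dotvC u). Qed.

Lemma dotvZr (R : realType) d (a : R) (v w : 'rV[R]_d) :
  dotv v (a *: w) = a * dotv v w.
Proof. by rewrite dotvC dotvZl dotvC. Qed.

Lemma dotvNl (R : realType) d (v w : 'rV[R]_d) : dotv (- v) w = - dotv v w.
Proof. by rewrite -scaleN1r dotvZl mulN1r. Qed.

Lemma dotvNr (R : realType) d (v w : 'rV[R]_d) : dotv v (- w) = - dotv v w.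
Proof. by rewrite dotvC dotvNl dotvC. Qed.

Lemma dotv_row_mx (R : realType) n m (z : 'rV[R]_(n + m)) x u :
  dotv (row_mx x u) z = dotv x (lsubmx z) + dotv u (rsubmx z).
Proof.
rewrite /dotv big_split_ord /=; congr (_ + _); apply: eq_bigr => i _.
  by rewrite row_mxEl mxE.
by rewrite row_mxEr mxE.
Qed.

Lemma dotvv_ge0 (R : realType) d (v : 'rV[R]_d) : 0 <= dotv v v.
Proof. by apply: sumr_ge0 => i _; rewrite -expr2 sqr_ge0. Qed.

Lemma dotvv_eq0 (R : realType) d (v : 'rV[R]_d) : (dotv v v == 0) = (v == 0).
Proof.
apply/eqP/eqP => [v0|->]; last by apply: big1 => i _; rewrite mxE mul0r.
apply/rowP => i; rewrite mxE; apply/eqP; rewrite -sqrf_eq0 expr2; apply/eqP.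
have /= := @psumr_eq0P _ _ xpredT (fun i => v 0 i * v 0 i) _ v0.
by apply=> // j _; rewrite -expr2 sqr_ge0.
Qed.

Lemma enorm_ge0 (R : realType) d (v : 'rV[R]_d) : 0 <= enorm v.
Proof. exact: sqrtr_ge0. Qed.

Lemma sqr_enorm (R : realType) d (v : 'rV[R]_d) : enorm v ^+ 2 = dotv v v.
Proof. by rewrite sqr_sqrtr ?dotvv_ge0. Qed.

Lemma enorm_eq0 (R : realType) d (v : 'rV[R]_d) : (enorm v == 0) = (v == 0).
Proof. by rewrite -sqrf_eq0 sqr_enorm dotvv_eq0. Qed.

Lemma enorm0 (R : realType) d : enorm (0 : 'rV[R]_d) = 0.
Proof. by apply/eqP; rewrite enorm_eq0. Qed.

Lemma enormZ (R : realType) d (a : R) (v : 'rV[R]_d) :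
  enorm (a *: v) = `|a| * enorm v.
Proof.
by rewrite /enorm dotvZl dotvZr mulrA -expr2 sqrtrM ?sqr_ge0// sqrtr_sqr.
Qed.

Lemma enormN (R : realType) d (v : 'rV[R]_d) : enorm (- v) = enorm v.
Proof. by rewrite /enorm dotvNl dotvNr opprK. Qed.

Lemma enormB (R : realType) d (v w : 'rV[R]_d) : enorm (v - w) = enorm (w - v).
Proof. by rewrite -enormN opprB. Qed.

Lemma cauchy_schwarz (R : realType) d (v w : 'rV[R]_d) :
  dotv v w <= enorm v * enorm w.
Proof.
have [->|w0] := eqVneq w 0; first by rewrite enorm0 mulr0 dotvC dotv0l.
have w1 : 0 < enorm w by rewrite lt_def enorm_ge0 enorm_eq0 w0.
have [->|v0] := eqVneq v 0; first by rewrite enorm0 mul0r dotv0l.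
have v1 : 0 < enorm v by rewrite lt_def enorm_ge0 enorm_eq0 v0.
have := dotvv_ge0 (enorm w *: v - enorm v *: w).
rewrite dotvDl !dotvDr !dotvNl !dotvNr !dotvZl !dotvZr -!sqr_enorm (dotvC w v).
set a := enorm v; set b := enorm w; set c := dotv v w => h.
have : 0 <= 2 * (a * b) * (a * b - c) by move: h; congr (_ <= _); ring.
by rewrite pmulr_rge0 ?subr_ge0// !mulr_gt0.
Qed.

Lemma enormD (R : realType) d (v w : 'rV[R]_d) :
  enorm (v + w) <= enorm v + enorm w.
Proof.
rewrite -(@ler_pXn2r _ 2) ?nnegrE ?addr_ge0 ?enorm_ge0//.
rewrite sqrrD !sqr_enorm dotvDl !dotvDr (dotvC w v).
have := cauchy_schwarz v w; lra.
Qed.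

(** This comparison is what relates Euclidean estimates to the topology, which
is the one of the sup norm. *)
Lemma norm_le_enorm (R : realType) d (v : 'rV[R]_d) : `|v| <= enorm v.
Proof.
have -> : `|v| = mx_norm v by [].
rewrite mx_normrE; apply/bigmax_leP; split; first exact: enorm_ge0.
move=> [i j] _ /=; rewrite (ord1 i) -sqrtr_sqr ler_wsqrtr//.
rewrite /dotv (bigD1 j)//= -expr2 lerDl; apply: sumr_ge0 => k _.
by rewrite -expr2 sqr_ge0.
Qed.

(** * Convergence of vectors *)

Lemma cvg_dotv (R : realType) T (F : set_system T) {FF : Filter F} d
    (v w : T -> 'rV[R]_d) (a b : 'rV[R]_d) :
  v @ F --> a -> w @ F --> b -> dotv (v x) (w x) @[x --> F] --> dotv a b.
Proof.
move=> va wb; apply: cvg_big => [|i _]; first exact: add_continuous.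
apply: (@cvgM _ _ _ FF (fun x => v x 0 i) (fun x => w x 0 i)).
  exact: (continuous_cvg _ (@coord_continuous _ _ _ 0 i a) va).
exact: (continuous_cvg _ (@coord_continuous _ _ _ 0 i b) wb).
Qed.

Lemma cvg_enorm (R : realType) T (F : set_system T) {FF : Filter F} d
    (v : T -> 'rV[R]_d) (a : 'rV[R]_d) :
  v @ F --> a -> enorm (v x) @[x --> F] --> enorm a.
Proof.
move=> va.
exact: (continuous_cvg _ (@sqrt_continuous R (dotv a a)) (cvg_dotv va va)).
Qed.

Lemma cvg_lsubmx (R : realType) T (F : set_system T) {FF : Filter F} n m
    (z : T -> 'rV[R]_(n + m)) (a : 'rV[R]_(n + m)) :
  z @ F --> a -> lsubmx (z x) @[x --> F] --> lsubmx a.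
Proof.
by move=> za; exact: (continuous_cvg _ (@continuous_lsubmx _ _ _ _ a) za).
Qed.

Lemma cvg_rsubmx (R : realType) T (F : set_system T) {FF : Filter F} n m
    (z : T -> 'rV[R]_(n + m)) (a : 'rV[R]_(n + m)) :
  z @ F --> a -> rsubmx (z x) @[x --> F] --> rsubmx a.
Proof.
by move=> za; exact: (continuous_cvg _ (@continuous_rsubmx _ _ _ _ a) za).
Qed.

Lemma norm_row_mx (R : realType) n m (x : 'rV[R]_n) (u : 'rV[R]_m) :
  `|row_mx x u| = Num.max `|x| `|u|.
Proof.
apply/eqP; rewrite eq_le; apply/andP; split.
  have -> : `|row_mx x u| = mx_norm (row_mx x u) by [].
  rewrite mx_normrE; apply/bigmax_leP; split; first by rewrite le_max normr_ge0.
  move=> [i j] _ /=; rewrite mxE le_max; case: splitP => k _.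
    apply/orP; left.
    have -> : `|x| = mx_norm x by [].
    by rewrite mx_normrE; apply/bigmax_geP; right; exists (i, k).
  apply/orP; right.
  have -> : `|u| = mx_norm u by [].
  by rewrite mx_normrE; apply/bigmax_geP; right; exists (i, k).
have -> : `|row_mx x u| = mx_norm (row_mx x u) by [].
rewrite ge_max; apply/andP; split.
  have -> : `|x| = mx_norm x by [].
  rewrite !mx_normrE; apply/bigmax_leP; split.
    by apply/bigmax_geP; left.
  move=> [i j] _ /=; apply/bigmax_geP; right; exists (i, lshift m j) => //=.
  by rewrite row_mxEl.
have -> : `|u| = mx_norm u by [].
rewrite !mx_normrE; apply/bigmax_leP; split.
  by apply/bigmax_geP; left.
move=> [i j] _ /=; apply/bigmax_geP; right; exists (i, rshift n j) => //=.
by rewrite row_mxEr.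
Qed.

(** Extraction is encoded by an index map k with j <= k j rather than by an
increasing one, which spares ordering the indices that are chosen. *)
Lemma cvg_index (k : nat -> nat) : (forall j, (j <= k j)%N) -> k @ \oo --> \oo.
Proof.
move=> kj A [N _ NA]; exists N => // j /= Nj; apply: NA => /=.
exact: leq_trans (kj j).
Qed.

Lemma bounded_cvg_index (R : realType) d (u : nat -> 'rV[R]_d) (M : R) :
  (forall j, `|u j| <= M) ->
  exists (k : nat -> nat) (l : 'rV[R]_d),
    (forall j, (j <= k j)%N) /\ u (k j) @[j --> \oo] --> l.
Proof.
move=> uM; pose A := [set v : 'rV[R]_d | `|v| <= M].
have cA : compact A.
  apply: bounded_closed_compact.
    by exists M; split => [|x Mx v /= /le_trans]; [exact: num_real|apply; exact: ltW].
  by apply: (@preimage_closed _ _ _ [set x : R | x <= M]) => [v _|];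
    [exact: norm_continuous|exact: closed_le].
have [|l [_ cl]] := cA (u @ \oo) _; first by exists 0%N => // j _; exact: uM.
have ex j : exists i, (j <= i)%N /\ `|l - u i| < j.+1%:R^-1.
  have [//||y [[i /= ji <-] /= h]] :=
    cl (u @` [set i | (j <= i)%N]) (ball l j.+1%:R^-1).
  - by exists j => // i /= ji; exists i.
  - by apply: nbhsx_ballx; rewrite invr_gt0.
  - by exists i; split => //; move: h; rewrite -ball_normE.
have [k kP] := choice ex; exists k, l; split => [j|]; first by have [] := kP j.
apply/cvgrPdist_lt => e e0.
have := near_infty_natSinv_lt (PosNum e0); apply: filterS => j.
by apply: lt_trans; have [] := kP j.
Qed.

(** * Tangent cones and projections *)

Lemma proj_mem (R : realType) d (A : set 'rV[R]_d) x :
  A x -> Defs.proj A x = [set x].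
Proof.
move=> Ax; apply/seteqP; split => [p [Ap /(_ x Ax)]|p ->] /=.
  rewrite subrr enorm0 => h; apply/esym/eqP.
  by rewrite -subr_eq0 -enorm_eq0 eq_le h enorm_ge0.
by split => // a _; rewrite subrr enorm0 enorm_ge0.
Qed.

Lemma tangent_coneZ (R : realType) d (A : set 'rV[R]_d) x w (s : R) :
  0 < s -> tangent_cone A x w -> tangent_cone A x (s *: w).
Proof.
move=> s0 [t [w_ [t0 tcv wcv Ax]]].
exists (fun k => t k / s), (fun k => s *: w_ k); split.
- by move=> k; rewrite divr_gt0.
- by rewrite -(mul0r s^-1); apply: cvgMl.
- by apply: cvgZr.
- by move=> k; rewrite scalerA mulfVK ?gt_eqF.
Qed.

Lemma tangent_cone0 (R : realType) d (A : set 'rV[R]_d) x :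
  A x -> tangent_cone A x 0.
Proof.
move=> Ax; exists (fun k => k.+1%:R^-1), (fun=> 0); split.
- by move=> k; rewrite invr_gt0.
- exact: cvg_harmonic.
- exact: cvg_cst.
- by move=> k; rewrite scaler0 addr0.
Qed.

(** Optimality of p along its own ray: compare p with s p for s < 1, and let s
tend to 1. This bounds the length of p by the values of x on T. *)
Lemma proj_cone_ineq (R : realType) d (T : set 'rV[R]_d) x p :
  (forall w (s : R), 0 < s -> T w -> T (s *: w)) -> Defs.proj T x p ->
  enorm p ^+ 2 <= dotv x p.
Proof.
move=> TZ [Tp pmin].
have key s : 0 < s < 1 -> (1 + s) * enorm p ^+ 2 <= 2 * dotv x p.
  move=> /andP[s0 s1]; have := pmin _ (TZ p s s0 Tp).
  move/(lerXn2r 2 (enorm_ge0 _) (enorm_ge0 _)); rewrite !sqr_enorm.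
  rewrite !dotvDl !dotvDr !dotvNl !dotvNr !dotvZl !dotvZr (dotvC p x).
  set a := dotv x x; set b := dotv x p; set c := dotv p p => h.
  have : 0 <= (1 - s) * (2 * b - (1 + s) * c) by nra.
  by rewrite pmulr_rge0 ?subr_gt0// subr_ge0.
rewrite leNgt; apply/negP => h.
have /(_ (dotv x p)) : forall b, b < enorm p ^+ 2 -> 
    (forall s, 0 < s < 1 -> (1 + s) * enorm p ^+ 2 <= 2 * b) -> False.
  move: (sqr_ge0 (enorm p)); set c := _ ^+ 2 => c0 b bc hs.
  have c1 : 0 < c by have := hs 2^-1; lra.
  have b0 : 0 < b by have := hs 2^-1; lra.
  have := hs (b / c); rewrite divr_gt0// ltr_pdivrMr// mul1r bc mulrDl mul1r.
  by rewrite divfK ?gt_eqF// => /(_ isT); lra.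
exact.
Qed.

Lemma gph_restrE (R : realType) n m (S : 'rV[R]_n -> set 'rV[R]_m) X z :
  gph (restr S X) z <-> X (lsubmx z) /\ S (lsubmx z) (rsubmx z).
Proof.
rewrite /gph /restr /patch /=; case: ifPn => [/set_mem|/negP h]; first by tauto.
by split=> // -[/mem_set].
Qed.

Lemma convex_segment (R : realType) d (X : set 'rV[R]_d) x y (t : R) :
  convex_set X -> X x -> X y -> 0 <= t <= 1 -> X (x + t *: (y - x)).
Proof.
move=> Xc Xx Xy /andP[t0 t1].
have ti : Itv.spec (@Itv.num_sem R) (Itv.Real `[0, 1]%Z) t.
  by apply/and3P; split; rewrite ?num_real//= in_itv /= t0.
have := Xc y x (Itv.mk ti) (mem_set Xy) (mem_set Xx).
move=> /set_mem; congr X.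
rewrite /conv /= /unstable.onem scalerBr scalerBl scale1r.
by rewrite addrCA.
Qed.

Lemma tangent_cone_segment (R : realType) d (X : set 'rV[R]_d) x y :
  convex_set X -> X x -> X y -> tangent_cone X x (y - x).
Proof.
move=> Xc Xx Xy; exists (fun k => k.+1%:R^-1), (fun=> y - x); split.
- by move=> k; rewrite invr_gt0.
- exact: cvg_harmonic.
- exact: cvg_cst.
- move=> k; apply: convex_segment => //.
  by rewrite invr_ge0 ler0n invf_le1 ?ltr0n// ler1n.
Qed.

(** * The Lipschitz inclusion bounds the coderivative *)

Lemma convex_segment_near (R : realType) d (X V : set 'rV[R]_d) x y :
  convex_set X -> X x -> X y -> nbhs x V ->
  exists2 c : R, 0 < c & forall t, 0 <= t <= c -> (X `&` V) (x + t *: (y - x)).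
Proof.
move=> Xc Xx Xy /nbhs_normP[e /= e0 eV].
have D0 : 0 < `|y - x| + 1 by rewrite ltr_wpDl.
have eD : 0 < e / (`|y - x| + 1) by rewrite divr_gt0.
exists (Num.min 1 (e / (`|y - x| + 1) / 2)).
  by rewrite lt_min ltr01 divr_gt0.
move=> t /andP[t0]; rewrite le_min => /andP[t1 te].
split; first by apply: convex_segment => //; rewrite t0.
apply: eV => /=; rewrite opprD addrA subrr sub0r normrN normrZ ger0_norm//.
have : t < e / (`|y - x| + 1) by lra.
rewrite ltr_pdivlMr//; apply: le_lt_trans.
by rewrite ler_wpM2l// lerDl.
Qed.

(** The inclusion, used from x towards x + t (y - x), produces points of the
graph whose second component moves at speed at most [kappa * enorm (y - x)]; a limit
of these velocities is tangent to the graph, and v is normal to it. *)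
Lemma regular_normal_bound (R : realType) n m (S : 'rV[R]_n -> set 'rV[R]_m)
    (X V : set 'rV[R]_n) (W : set 'rV[R]_m) (kappa : R) (z v : 'rV[R]_(n + m))
    (y : 'rV[R]_n) :
  convex_set X -> lip_inclusion S X V W kappa -> 0 <= kappa ->
  nbhs (lsubmx z) V -> W (rsubmx z) ->
  gph (restr S X) z -> regular_normal_cone (gph (restr S X)) z v -> X y ->
  dotv (lsubmx v) (y - lsubmx z) <=
    kappa * enorm (rsubmx v) * enorm (y - lsubmx z).
Proof.
move=> Xc lip k0 Vx Wu /gph_restrE[Xx Su] Nv Xy.
set x := lsubmx z in Vx Xx Su *; set u := rsubmx z in Wu Su.
have [c c0 cXV] := convex_segment_near Xc Xx Xy Vx.
(* A tangent sequence must satisfy its constraint at every index, so the steps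
   start at c, below which the segment stays in V. *)
pose t k : R := c * k.+1%:R^-1.
have t0 k : 0 < t k by rewrite mulr_gt0 ?invr_gt0.
have tc k : t k <= c by rewrite ger_pMr// invf_le1 ?ltr0n// ler1n.
have ex k : exists e : 'rV[R]_m, enorm e <= 1 /\
    S (x + t k *: (y - x)) (u - (t k * (kappa * enorm (y - x))) *: e).
  have XVt : (X `&` V) (x + t k *: (y - x)).
    by apply: cXV; rewrite (ltW (t0 k)) tc.
  have XVx : (X `&` V) x by split => //; exact: nbhs_singleton.
  have [a Sa [b [e e1 <-] abu]] := lip _ _ XVt XVx _ (conj Su Wu).
  exists e; split => //.
  move: abu; rewrite opprD addrA subrr sub0r enormN enormZ gtr0_norm// => abu.
  by rewrite -abu mulrCA addrK.
have [e eP] := choice ex.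
have e1 k : `|e k| <= 1 by apply: le_trans (norm_le_enorm _) _; have [] := eP k.
have [k [l [jk el]]] := bounded_cvg_index e1.
have l1 : enorm l <= 1.
  apply: (cvgr_to_le (cvg_enorm el)).
  by apply: nearW => j; have [] := eP (k j).
have /Nv : tangent_cone (gph (restr S X)) z
    (row_mx (y - x) (- (kappa * enorm (y - x)) *: l)).
  exists (t \o k),
    (fun j => row_mx (y - x) (- (kappa * enorm (y - x)) *: e (k j))).
  split => [j| | |j]; first exact: t0.
  - apply: (@cvg_comp _ _ _ k t) (cvg_index jk) _.
    by rewrite -(mulr0 c); apply: cvgMr; exact: cvg_harmonic.
  - have : - (kappa * enorm (y - x)) *: e (k j) @[j --> \oo] -->
        - (kappa * enorm (y - x)) *: l by exact: cvgZr.
    set a_ := fun j => _; set a := _ *: l => aa.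
    apply/cvgrPdist_lt => d d0; have /cvgrPdist_lt/(_ d d0) := aa.
    apply: filterS => j; rewrite opp_row_mx add_row_mx subrr norm_row_mx.
    by rewrite normr0 gt_max d0.
  - apply/gph_restrE; rewrite !linearD !linearZ /= row_mxKl row_mxKr -/x -/u.
    have [_ Se] := eP (k j); split.
      by have [] := cXV (t (k j)) _; rewrite ?(ltW (t0 _)) ?tc.
    by move: Se; rewrite scalerN scaleNr scalerN scalerA.
rewrite -{1}(hsubmxK v) dotv_row_mx row_mxKl row_mxKr dotvZr mulNr subr_le0.
move=> /le_trans; apply; rewrite [leRHS]mulrAC ler_wpM2l ?mulr_ge0 ?enorm_ge0//.
apply: le_trans (cauchy_schwarz _ _) _.
by rewrite ler_piMr ?enorm_ge0.
Qed.

Lemma cvg_nbhs_near (R : realType) d (z : nat -> 'rV[R]_d) (a : 'rV[R]_d)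
    (V : set 'rV[R]_d) :
  z @ \oo --> a -> nbhs a V -> \forall j \near \oo, nbhs (z j) V.
Proof. by move=> za /nbhs_interior Va; exact: (za _ Va). Qed.

(** The estimate for regular normals involves the base point only through
y - x with y in X fixed, so unlike an estimate over the tangent cone at the
base point it passes to the limit directly. *)
Lemma normal_bound (R : realType) n m (S : 'rV[R]_n -> set 'rV[R]_m)
    (X V : set 'rV[R]_n) (W : set 'rV[R]_m) (kappa : R) (z v : 'rV[R]_(n + m))
    (y : 'rV[R]_n) :
  convex_set X -> lip_inclusion S X V W kappa -> 0 <= kappa ->
  nbhs (lsubmx z) V -> nbhs (rsubmx z) W ->
  normal_cone (gph (restr S X)) z v -> X y ->
  dotv (lsubmx v) (y - lsubmx z) <=
    kappa * enorm (rsubmx v) * enorm (y - lsubmx z).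
Proof.
move=> Xc lip k0 Vx Wu [z_ [v_ [zz vv N]]] Xy.
have yz : y - lsubmx (z_ j) @[j --> \oo] --> y - lsubmx z.
  by apply: cvgB; [exact: cvg_cst|exact: cvg_lsubmx].
rewrite -subr_ge0; apply: (cvgr_to_ge
  (cvgB (cvgM (cvgM (cvg_cst kappa) (cvg_enorm (cvg_rsubmx vv)))
              (cvg_enorm yz))
        (cvg_dotv (cvg_lsubmx vv) yz))).
have nV := cvg_nbhs_near (cvg_lsubmx zz) Vx.
have nW := cvg_nbhs_near (cvg_rsubmx zz) Wu.
near=> j; rewrite subr_ge0; have [Gz Nz] := N j.
apply: (regular_normal_bound Xc lip k0 _ _ Gz Nz Xy).
- by near: j; exact: nV.
- by apply: nbhs_singleton; near: j; exact: nW.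
Unshelve. all: by end_near.
Qed.

(** The previous estimate, applied to points of X that realise the tangent
direction p, reads <xs, p> <= kappa |us| |p| in the limit. *)
Lemma coderivative_proj_bound (R : realType) n m
    (S : 'rV[R]_n -> set 'rV[R]_m) (X V : set 'rV[R]_n) (W : set 'rV[R]_m)
    (kappa : R) x u us xs p :
  convex_set X -> lip_inclusion S X V W kappa -> 0 <= kappa ->
  nbhs x V -> nbhs u W ->
  coderivative (restr S X) x u us xs -> Defs.proj (tangent_cone X x) xs p ->
  enorm p <= kappa * enorm us.
Proof.
move=> Xc lip k0 Vx Wu N Pp.
have [Tp _] := Pp.
have pp : enorm p ^+ 2 <= kappa * enorm us * enorm p.
  apply: (le_trans (proj_cone_ineq _ Pp)) => [w s|]; first exact: tangent_coneZ.
  have [t [w [t0 _ wp Xw]]] := Tp.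
  rewrite -subr_ge0; apply: (cvgr_to_ge
    (cvgB (cvgM (cvg_cst (kappa * enorm us)) (cvg_enorm wp))
          (cvg_dotv (cvg_cst xs) wp))).
  apply: nearW => k.
  have := @normal_bound _ _ _ S X V W kappa (row_mx x u) _ _
    Xc lip k0 _ _ N (Xw k).
  rewrite !row_mxKl !row_mxKr enormN [_ - x]addrAC subrr add0r dotvZr enormZ.
  rewrite gtr0_norm// mulrCA ler_pM2l// subr_ge0; exact.
have [p0|p0] := eqVneq (enorm p) 0; first by rewrite p0 mulr_ge0 ?enorm_ge0.
have p1 : 0 < enorm p by rewrite lt_def p0 enorm_ge0.
by move: pp; rewrite expr2 ler_pM2r.
Qed.

Lemma proj_coderivative_bound (R : realType) n m
    (S : 'rV[R]_n -> set 'rV[R]_m) (X V : set 'rV[R]_n) (W : set 'rV[R]_m)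
    (kappa : R) x u us xs :
  convex_set X -> lip_inclusion S X V W kappa -> 0 <= kappa ->
  nbhs x V -> nbhs u W ->
  proj_coderivative S X x u us xs -> enorm xs <= kappa * enorm us.
Proof.
move=> Xc lip k0 Vx Wu [x_ [u_ [xs_ [us_ [p_ [[xx uu] _ N usus [pP pp]]]]]]].
rewrite -subr_ge0; apply: (cvgr_to_ge
  (cvgB (cvgM (cvg_cst kappa) (cvg_enorm usus)) (cvg_enorm pp))).
have nV := cvg_nbhs_near xx Vx; have nW := cvg_nbhs_near uu Wu.
near=> k; rewrite subr_ge0.
apply: (coderivative_proj_bound Xc lip k0 _ _ (N k)).
- by near: k; exact: nV.
- by near: k; exact: nW.
- by rewrite pP.
Unshelve. all: by end_near.
Qed.

(** * Normals produced by a failure of the inclusion *)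

Lemma nbhs_eball (R : realType) d (x : 'rV[R]_d) (r : R) :
  0 < r -> nbhs x [set y | enorm (y - x) < r].
Proof.
move=> r0.
have : enorm (y - x) @[y --> x] --> enorm (x - x).
  apply: (@cvg_enorm _ _ (nbhs x) _ _ (fun y => y - x)).
  by apply: cvgB; [exact: cvg_id|exact: cvg_cst].
by rewrite subrr enorm0 => /cvgr_lt/(_ _ r0).
Qed.

(** Fermat's rule: minus half the gradient of a smooth function, here a
quadratic one, at a local minimiser over G is a regular normal to G. *)
Lemma regular_normal_quadratic (R : realType) n m (G U : set 'rV[R]_(n + m))
    (z : 'rV[R]_(n + m)) (x : 'rV[R]_n) (u : 'rV[R]_m) (a b : R) :
  nbhs z U ->
  (forall z', G z' -> U z' ->
    a * enorm (lsubmx z - x) ^+ 2 + b * enorm (rsubmx z - u) ^+ 2 <=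
    a * enorm (lsubmx z' - x) ^+ 2 + b * enorm (rsubmx z' - u) ^+ 2) ->
  regular_normal_cone G z (row_mx (a *: (x - lsubmx z)) (b *: (u - rsubmx z))).
Proof.
move=> Uz zmin w [t [w_ [t0 tcv wcv Gz]]].
rewrite dotv_row_mx -(opprB _ x) -(opprB _ u) !scalerN !dotvNl !dotvZl.
set p := lsubmx z - x; set q := rsubmx z - u.
suff : 0 <= a * (2 * dotv p (lsubmx w) + 0 * dotv (lsubmx w) (lsubmx w)) +
            b * (2 * dotv q (rsubmx w) + 0 * dotv (rsubmx w) (rsubmx w)) by lra.
have lw : lsubmx (w_ k) @[k --> \oo] --> lsubmx w by exact: cvg_lsubmx.
have rw : rsubmx (w_ k) @[k --> \oo] --> rsubmx w by exact: cvg_rsubmx.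
apply: (cvgr_to_ge (cvgD
  (cvgM (cvg_cst a) (cvgD (cvgM (cvg_cst (2 : R)) (cvg_dotv (cvg_cst p) lw))
                         (cvgM tcv (cvg_dotv lw lw))))
  (cvgM (cvg_cst b) (cvgD (cvgM (cvg_cst (2 : R)) (cvg_dotv (cvg_cst q) rw))
                         (cvgM tcv (cvg_dotv rw rw)))))).
have : z + t k *: w_ k @[k --> \oo] --> z + 0 *: w.
  exact: (cvgD (cvg_cst z) (cvgZ tcv wcv)).
rewrite scale0r addr0 => zcv.
have zU : \forall k \near \oo, U (z + t k *: w_ k) by exact: (zcv _ Uz).
near=> k.
change (0 <=
  a * (2 * dotv p (lsubmx (w_ k)) +
       t k * dotv (lsubmx (w_ k)) (lsubmx (w_ k))) +
  b * (2 * dotv q (rsubmx (w_ k)) +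
       t k * dotv (rsubmx (w_ k)) (rsubmx (w_ k)))).
have Uk : U (z + t k *: w_ k) by near: k.
have := zmin _ (Gz k) Uk.
have -> : lsubmx (z + t k *: w_ k) - x = p + t k *: lsubmx (w_ k).
  by rewrite linearD linearZ addrAC.
have -> : rsubmx (z + t k *: w_ k) - u = q + t k *: rsubmx (w_ k).
  by rewrite linearD linearZ addrAC.
rewrite -/p -/q; move: (p) (q) => {zmin}p' q'.
rewrite !sqr_enorm !dotvDl !dotvDr !dotvZl !dotvZr.
rewrite (dotvC (lsubmx (w_ k)) p') (dotvC (rsubmx (w_ k)) q').
have s0 := t0 k; rewrite -subr_ge0 => h.
rewrite -(pmulr_rge0 _ s0); move: h.
by congr (_ <= _); ring.
Unshelve. all: by end_near.
Qed.

(** The majorant of the square root by its tangent line, written for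
s = sqrt A and s' = sqrt B. It replaces a sum of Euclidean distances by a
quadratic function touching it from above, which therefore has the same local
minimiser; no derivative of a norm is then needed. *)
Lemma le_half_sqr (R : realType) (c s s' : R) :
  0 <= c -> 0 < s -> c * (s' - s) <= c / s / 2 * (s' ^+ 2 - s ^+ 2).
Proof.
move=> c0 s0; rewrite -subr_ge0.
have -> : c / s / 2 * (s' ^+ 2 - s ^+ 2) - c * (s' - s) =
  c / s / 2 * (s' - s) ^+ 2 by field; rewrite gt_eqF.
by rewrite mulr_ge0 ?sqr_ge0// divr_ge0// divr_ge0// ltW.
Qed.

(** The minimisation argument. The two scales a and b are kept separate because
the modulus formula needs b = 1 with a close to kappa, whereas the criterion at
0 needs a = 1 with b tending to 0. *)
Lemma regular_normal_of_failure (R : realType) n m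
    (S : 'rV[R]_n -> set 'rV[R]_m) (X : set 'rV[R]_n)
    (xbar : 'rV[R]_n) (ubar : 'rV[R]_m) (a b kappa eps : R) :
  locally_closed (gph S) (row_mx xbar ubar) -> closed X -> convex_set X ->
  0 < a -> 0 < b -> a < b * kappa -> 0 < eps ->
  (forall V W, nbhs xbar V -> nbhs ubar W -> ~ lip_inclusion S X V W kappa) ->
  exists z xs us, [/\ gph (restr S X) z, `|z - row_mx xbar ubar| < eps,
    regular_normal_cone (gph (restr S X)) z (row_mx xs (- us)),
    tangent_cone X (lsubmx z) xs & enorm xs = a /\ enorm us <= b].
Proof.
set zb := row_mx xbar ubar.
move=> [U [Uz Ucl SUcl]] Xcl Xc a0 b0 abk eps0 nlip.
have k0 : 0 < kappa by rewrite -(pmulr_rgt0 _ b0) (lt_trans a0).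
have [rho [rho0 rhoe rhoU]] : exists rho, [/\ 0 < rho, rho < eps &
    forall z, `|z - zb| <= rho -> U z].
  move: Uz => /nbhs_normP[r /= r0 rU].
  exists (Num.min r eps / 2); split.
  - by rewrite divr_gt0// lt_min r0.
  - have : Num.min r eps <= eps by rewrite ge_min lexx orbT.
    lra.
  - move=> z zr; apply: rU => /=; rewrite distrC.
    have : Num.min r eps <= r by rewrite ge_min lexx.
    move: zr; lra.
(* C bounds the displacement of the minimiser from the reference point, in
   units of tau: with tau = rho / C it is interior to the ball of radius rho. *)
pose C := 2 * (b * kappa / a) + 2 * kappa + 2.
have ck : 0 < b * kappa / a by rewrite divr_gt0// mulr_gt0.
have C0 : 0 < C by rewrite /C; lra.
pose tau := rho / C.
have tau0 : 0 < tau by rewrite divr_gt0.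
have tauC : tau * C = rho by rewrite mulfVK ?gt_eqF.
have [x [x' [u' [[Xx xt] [Xx' xt'] [Su' ut] far]]]] : exists x x' u',
    [/\ X x /\ enorm (x - xbar) < tau, X x' /\ enorm (x' - xbar) < tau,
        S x' u' /\ enorm (u' - ubar) < tau &
        forall u, S x u -> kappa * enorm (x' - x) < enorm (u' - u)].
  have := nlip _ _ (nbhs_eball xbar tau0) (nbhs_eball ubar tau0).
  move=> /existsNP[x /existsNP[x' /not_implyP[[Xx xt] /not_implyP[[Xx' xt']]]]].
  move=> /existsNP[u' /not_implyP[[Su' ut] nb]].
  exists x, x', u'; split => // u Su.
  rewrite ltNge; apply/negP => le_u; apply: nb.
  exists u => //.
  have [r0|r0] := eqVneq (kappa * enorm (x' - x)) 0.
    exists 0; last first.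
      rewrite addr0; apply/eqP; rewrite eq_sym -subr_eq0 -enorm_eq0.
      by rewrite eq_le enorm_ge0 andbT -r0.
    by exists 0; rewrite ?scaler0// /unit_eball /= enorm0.
  have r1 : 0 < kappa * enorm (x' - x).
    by rewrite lt_def r0 mulr_ge0 ?enorm_ge0// ltW.
  exists (u' - u); last by rewrite addrC subrK.
  exists ((kappa * enorm (x' - x))^-1 *: (u' - u)).
    rewrite /unit_eball /= enormZ gtr0_norm ?invr_gt0//.
    by rewrite mulrC ler_pdivrMr// mul1r.
  by rewrite scalerA divff// scale1r.
set r := enorm (x' - x) in far.
have r0 : 0 < r.
  rewrite lt_def enorm_ge0 andbT; apply/eqP => r0.
  have xx : x' = x by apply/eqP; rewrite -subr_eq0 -enorm_eq0 -/r r0.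
  by have := far u'; rewrite -xx subrr enorm0 r0 mulr0 ltxx => /(_ Su').
have rtau : r < 2 * tau.
  have := enormD (x' - xbar) (xbar - x); rewrite addrA subrK -/r.
  rewrite (enormB xbar x); lra.
(* With this delta the function below takes the value b kappa r at (x', u'),
   while it exceeds that value at every point of S(x). *)
pose delta := (b * kappa - a) * r / b.
have delta0 : 0 < delta by rewrite divr_gt0// mulr_gt0// subr_gt0.
pose g (v : 'rV[R]_m) := Num.sqrt (enorm (v - u') ^+ 2 + delta ^+ 2).
pose f (z : 'rV[R]_(n + m)) := a * enorm (lsubmx z - x) + b * g (rsubmx z).
have sqrg v : g v ^+ 2 = enorm (v - u') ^+ 2 + delta ^+ 2.
  by rewrite sqr_sqrtr// addr_ge0 ?sqr_ge0.
have g0 v : 0 < g v by rewrite sqrtr_gt0 ltr_wpDl ?sqr_ge0// exprn_gt0.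
have gge v : enorm (v - u') <= g v.
  rewrite -[leLHS]ger0_norm ?enorm_ge0// -sqrtr_sqr ler_wsqrtr//.
  by rewrite lerDl sqr_ge0.
have fcont : continuous f.
  move=> z.
  have lz : lsubmx z' - x @[z' --> z] --> lsubmx z - x.
    exact: (cvgB (@continuous_lsubmx _ _ _ _ z) (cvg_cst x)).
  have rz : rsubmx z' - u' @[z' --> z] --> rsubmx z - u'.
    exact: (cvgB (@continuous_rsubmx _ _ _ _ z) (cvg_cst u')).
  have gz : g (rsubmx z') @[z' --> z] --> g (rsubmx z).
    exact: (continuous_cvg _ (@sqrt_continuous R _)
      (cvgD (cvgM (cvg_enorm rz) (cvg_enorm rz)) (cvg_cst (delta ^+ 2)))).
  exact: (cvgD (cvgM (cvg_cst a) (cvg_enorm lz)) (cvgM (cvg_cst b) gz)).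
pose K := gph (restr S X) `&` [set z | `|z - zb| <= rho].
have Kcpt : compact K.
  apply: bounded_closed_compact.
    exists (rho + `|zb|); split; first exact: num_real.
    move=> M ltM z [_ /= zr]; apply: le_trans (ltW ltM).
    by rewrite -(subrK zb z) (le_trans (ler_normD _ _))// lerD2r.
  have -> : K = (gph S `&` U) `&` (lsubmx @^-1` X)
                `&` [set z | `|z - zb| <= rho].
    apply/seteqP; split => z /=.
      by move=> [/gph_restrE[? ?] /= zr]; split => //; split => //; split => //;
        exact: rhoU.
    by move=> [[[? _] ?] ?]; split => //; apply/gph_restrE.
  apply: closedI; first apply: closedI => //.
    by apply: preimage_closed => // z _; exact: continuous_lsubmx.
  have cn : continuous (fun z : 'rV[R]_(n + m) => `|z - zb|).
    by move=> z; exact: (cvg_norm (cvgB cvg_id (cvg_cst zb))).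
  exact: (preimage_closed (fun z _ => cn z) (@closed_le R rho)).
have tau_rho : tau < rho.
  by rewrite -tauC ltr_pMr// /C; lra.
have Kz' : K (row_mx x' u').
  split; first by apply/gph_restrE; rewrite row_mxKl row_mxKr.
  rewrite /= /zb opp_row_mx add_row_mx norm_row_mx ge_max.
  have := norm_le_enorm (x' - xbar); have := norm_le_enorm (u' - ubar).
  by move=> h1 h2; apply/andP; split; lra.
have [z /set_mem[Gz zr] zmin] := EVT_min_rV (ex_intro _ _ Kz') Kcpt
  (continuous_subspaceT fcont).
have fz : f z <= b * kappa * r.
  have := zmin _ (mem_set Kz').
  rewrite /f row_mxKl row_mxKr -/r /g subrr enorm0.
  rewrite expr0n /= add0r sqrtr_sqr gtr0_norm// /delta mulrCA.
  rewrite divff ?gt_eqF// mulr1.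
  by move/le_trans; apply; rewrite -mulrDl addrC subrK.
have /gph_restrE[Xz Sz] := Gz.
set y := lsubmx z in Xz Sz; set v := rsubmx z in Sz.
have fzE : f z = a * enorm (y - x) + b * g v by [].
have vu : enorm (v - u') <= kappa * r.
  apply: le_trans (gge v) _; rewrite -(ler_pM2l b0) mulrA; apply: le_trans fz.
  by rewrite fzE lerDr mulr_ge0 ?enorm_ge0// ltW.
have yx : enorm (y - x) <= b * kappa / a * r.
  rewrite -(ler_pM2l a0) mulrA (mulrCA a) divff ?gt_eqF// mulr1.
  apply: le_trans fz.
  by rewrite fzE lerDl mulr_ge0 ?ltW.
have zrho : `|z - zb| < rho.
  rewrite -(hsubmxK z) /zb opp_row_mx add_row_mx norm_row_mx gt_max -/y -/v.
  have yb : `|y - xbar| <= enorm (y - x) + enorm (x - xbar).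
    apply: le_trans (norm_le_enorm _) _.
    by have := enormD (y - x) (x - xbar); rewrite addrA subrK.
  have vb : `|v - ubar| <= enorm (v - u') + enorm (u' - ubar).
    apply: le_trans (norm_le_enorm _) _.
    by have := enormD (v - u') (u' - ubar); rewrite addrA subrK.
  have h1 : b * kappa / a * r <= b * kappa / a * (2 * tau).
    by rewrite ler_pM2l// ltW.
  have h2 : kappa * r <= kappa * (2 * tau) by rewrite ler_pM2l// ltW.
  have h3 : 0 <= kappa * tau by rewrite ltW// mulr_gt0.
  have h4 : 0 <= b * kappa / a * tau by rewrite ltW// mulr_gt0.
  have h5 : rho = 2 * (b * kappa / a * tau) + 2 * (kappa * tau) + 2 * tau.
    by rewrite -tauC /C; ring.
  by apply/andP; split; lra.
have L0 : 0 < enorm (y - x).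
  rewrite lt_def enorm_ge0 andbT enorm_eq0 subr_eq0; apply/eqP => yx0.
  have := far v; rewrite -yx0 => /(_ Sz).
  by rewrite enormB ltNge vu.
(* Minus the gradient of f at z is (xs, - us). *)
exists z, ((a / enorm (y - x)) *: (x - y)), ((b / g v) *: (v - u')).
split => //.
- exact: lt_trans zrho rhoe.
- rewrite -scalerN opprB.
  have -> : a / enorm (y - x) = 2 * (a / enorm (y - x) / 2) by lra.
  have -> : b / g v = 2 * (b / g v / 2) by lra.
  apply: (@regular_normal_quadratic _ _ _ _ [set z' | `|z' - zb| < rho]).
    have : `|z' - zb| @[z' --> z] --> `|z - zb|.
      exact: (cvg_norm (cvgB cvg_id (cvg_cst zb))).
    by move=> /cvgr_lt/(_ _ zrho).
  move=> z' Gz' /= z'rho.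
  have := zmin z' (mem_set (conj Gz' (ltW z'rho))).
  rewrite fzE /f => h.
  have h1 := le_half_sqr (enorm (lsubmx z' - x)) (ltW a0) L0.
  have h2 := le_half_sqr (g (rsubmx z')) (ltW b0) (g0 v).
  rewrite -/y -/v.
  move: h2; rewrite !sqrg.
  move: h1 h; set A := a / _ / 2; set B := b / _ / 2.
  lra.
- apply: tangent_coneZ; first by rewrite divr_gt0.
  exact: tangent_cone_segment.
- split.
    by rewrite enormZ (enormB x) gtr0_norm ?divr_gt0// divfK ?gt_eqF.
  rewrite enormZ gtr0_norm ?divr_gt0// -mulrA ger_pMr//.
  by rewrite mulrC ler_pdivrMr// mul1r.
Qed.

(** A tangent vector is its own projection on the tangent cone, so regular
normals whose first component is tangent to X qualify at once for the projectional
coderivative, up to extracting a convergent sequence. *)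
Lemma proj_coderivative_of_normals (R : realType) n m
    (S : 'rV[R]_n -> set 'rV[R]_m) (X : set 'rV[R]_n)
    (xbar : 'rV[R]_n) (ubar : 'rV[R]_m) (a b B : R) (b_ : nat -> R) :
  b_ @ \oo --> b -> (forall k, b_ k <= B) ->
  (forall k : nat, exists z xs us, [/\ gph (restr S X) z,
    `|z - row_mx xbar ubar| < k.+1%:R^-1,
    regular_normal_cone (gph (restr S X)) z (row_mx xs (- us)),
    tangent_cone X (lsubmx z) xs & enorm xs = a /\ enorm us <= b_ k]) ->
  exists us xs, [/\ proj_coderivative S X xbar ubar us xs,
    enorm xs = a & enorm us <= b].
Proof.
move=> bcv bB ex.
have {}ex k : exists d : 'rV[R]_(n + m) * ('rV[R]_n * 'rV[R]_m),
    [/\ gph (restr S X) d.1, `|d.1 - row_mx xbar ubar| < k.+1%:R^-1,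
    regular_normal_cone (gph (restr S X)) d.1 (row_mx d.2.1 (- d.2.2)),
    tangent_cone X (lsubmx d.1) d.2.1 & enorm d.2.1 = a /\ enorm d.2.2 <= b_ k].
  by have [z [xs [us h]]] := ex k; exists (z, (xs, us)).
have [d dP] := choice ex.
pose z k := (d k).1; pose xs k := (d k).2.1; pose us k := (d k).2.2.
have bnd k : `|row_mx (xs k) (us k)| <= Num.max a B.
  have [_ _ _ _ [xa ub]] := dP k.
  rewrite norm_row_mx ge_max !le_max; apply/andP; split; apply/orP.
    by left; rewrite -xa; exact: norm_le_enorm.
  right; apply: le_trans (bB k); apply: le_trans ub; exact: norm_le_enorm.
have [k [l [jk lcv]]] := bounded_cvg_index bnd.
have xcv : xs (k j) @[j --> \oo] --> lsubmx l.
  have -> : (fun j => xs (k j)) =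
      (fun j => lsubmx (row_mx (xs (k j)) (us (k j)))).
    by apply/funext => j; rewrite row_mxKl.
  exact: cvg_lsubmx.
have ucv : us (k j) @[j --> \oo] --> rsubmx l.
  have -> : (fun j => us (k j)) =
      (fun j => rsubmx (row_mx (xs (k j)) (us (k j)))).
    by apply/funext => j; rewrite row_mxKr.
  exact: cvg_rsubmx.
have zcv : z (k j) @[j --> \oo] --> row_mx xbar ubar.
  apply: (@cvg_comp _ _ _ k z) (cvg_index jk) _; apply/cvgrPdist_lt => e e0.
  have := near_infty_natSinv_lt (PosNum e0); apply: filterS => j /=.
  by rewrite distrC; apply: lt_trans; have [] := dP j.
exists (rsubmx l), (lsubmx l); split.
- exists (fun j => lsubmx (z (k j))), (fun j => rsubmx (z (k j))).
  exists (xs \o k), (us \o k), (xs \o k); split => //.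
  + split.
      by rewrite -[X in _ --> X](row_mxKl xbar ubar); exact: cvg_lsubmx.
    by rewrite -[X in _ --> X](row_mxKr xbar ubar); exact: cvg_rsubmx.
  + by move=> j; rewrite hsubmxK; have [] := dP (k j).
  + move=> j; rewrite /coderivative /= hsubmxK.
    exists (fun=> z (k j)), (fun=> row_mx (xs (k j)) (- us (k j))).
    by split; [exact: cvg_cst|exact: cvg_cst|move=> _; have [] := dP (k j)].
  + by split => // j; apply: proj_mem; have [] := dP (k j).
- have : enorm (xs (k j)) @[j --> \oo] --> enorm (lsubmx l) by exact: cvg_enorm.
  have -> : (fun j => enorm (xs (k j))) = (fun=> a).
    by apply/funext => j; have [_ _ _ _ []] := dP (k j).
  by move=> h; exact: (cvg_unique _ h (cvg_cst a)).
- have bk : b_ (k j) @[j --> \oo] --> b.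
    exact: (@cvg_comp _ _ _ k b_) (cvg_index jk) bcv.
  rewrite -subr_ge0; apply: (cvgr_to_ge (cvgB bk (cvg_enorm ucv))).
  by apply: nearW => j; rewrite subr_ge0; have [_ _ _ _ []] := dP (k j).
Qed.

Lemma proj_coderivative00 (R : realType) n m
    (S : 'rV[R]_n -> set 'rV[R]_m) (X : set 'rV[R]_n)
    (xbar : 'rV[R]_n) (ubar : 'rV[R]_m) :
  X xbar -> S xbar ubar -> proj_coderivative S X xbar ubar 0 0.
Proof.
move=> Xx Su; exists (fun=> xbar), (fun=> ubar), (fun=> 0), (fun=> 0), (fun=> 0).
have G : gph (restr S X) (row_mx xbar ubar).
  by apply/gph_restrE; rewrite row_mxKl row_mxKr.
split => //; [by split; exact: cvg_cst| |exact: cvg_cst|split; last exact: cvg_cst].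
- move=> _; exists (fun=> row_mx xbar ubar), (fun=> 0).
  split; [exact: cvg_cst|by rewrite oppr0 row_mx0; exact: cvg_cst|].
  by move=> _; split => // w _; rewrite dotv0l.
- by move=> _; apply: proj_mem; exact: tangent_cone0.
Qed.

(** * Outer norm and graphical modulus *)

Lemma outer_norm_le (R : realType) n m (H : 'rV[R]_m -> set 'rV[R]_n) (k : R) :
  0 <= k -> (forall y z, H y z -> enorm z <= k * enorm y) ->
  (outer_norm H <= k%:E)%E.
Proof.
move=> k0 Hk.
have sup0_le (A : set (\bar R)) : ubound A k%:E -> (Defs.sup0 A <= k%:E)%E.
  by rewrite /Defs.sup0; case: ifPn => [_ _|_ /ge_ereal_sup//]; rewrite lee_fin.
apply: (sup0_le) => _ [y /= y1 <-]; apply: sup0_le => _ [z /= Hz <-].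
by rewrite lee_fin (le_trans (Hk _ _ Hz))// ler_piMr.
Qed.

Lemma le_outer_norm (R : realType) n m (H : 'rV[R]_m -> set 'rV[R]_n) y z :
  enorm y <= 1 -> H y z -> ((enorm z)%:E <= outer_norm H)%E.
Proof.
have le_sup0 (A : set (\bar R)) r : A r -> (r <= Defs.sup0 A)%E.
  move=> Ar; rewrite /Defs.sup0; case: eqP => [A0|_].
    by move: Ar; rewrite A0.
  exact: ereal_sup_ubound.
move=> y1 Hz; apply: le_trans (le_sup0 _ _ _); last by exists y.
by apply: le_sup0; exists z.
Qed.

Theorem theorem2p4 (R : realType) (n m : nat)
    (S : 'rV[R]_n -> set 'rV[R]_m) (X : set 'rV[R]_n)
    (xbar : 'rV[R]_n) (ubar : 'rV[R]_m)
    (Xxbar : X xbar) (Subar : S xbar ubar)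
    (gphS_lc : locally_closed (gph S) (row_mx xbar ubar))
    (X_closed : closed X) (X_convex : convex_set X) :
  [/\ lipschitz_like S X xbar ubar <->
        proj_coderivative S X xbar ubar 0 = [set 0],
      proj_coderivative S X xbar ubar 0 = [set 0] <->
        (outer_norm (proj_coderivative S X xbar ubar) < +oo)%E &
      lip_modulus S X xbar ubar
        = outer_norm (proj_coderivative S X xbar ubar)].
Proof.
set D := proj_coderivative S X xbar ubar.
have D00 : D 0 0 by exact: proj_coderivative00.
have norm_ge0 : (0 <= outer_norm D)%E.
  by have := le_outer_norm _ D00; rewrite !enorm0; apply.
have lip_eq : lip_modulus S X xbar ubar = outer_norm D.
  apply/eqP; rewrite eq_le; apply/andP; split; last first.
    apply: le_ereal_inf_tmp => _ [k [k0 [V [W [Vx Wu lip]]]] <-].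
    by apply: outer_norm_le => // us xs;
    exact: proj_coderivative_bound lip k0 Vx Wu.
  rewrite leNgt; apply/negP => lt_norm.
  have fin : outer_norm D \is a fin_num.
    by rewrite ge0_fin_numE// (lt_le_trans lt_norm)// leey.
  (* Two constants strictly between the norm and the modulus: the inclusion
     fails for k, and a = k' < 1 * k gives an element of norm k'. *)
  have [k' [k [lt_k' k'k lt_k]]] : exists k' k : R,
      [/\ fine (outer_norm D) < k', k' < k & (k%:E < lip_modulus S X xbar ubar)%E].
    move: lt_norm; rewrite -{1}(fineK fin).
    case: (lip_modulus _ _ _ _) => [l|_|//].
      rewrite lte_fin; set o := fine _ => ol.
      exists (o + (l - o) / 3), (o + (l - o) / 3 * 2).
      by rewrite lte_fin; split; lra.
    by exists (fine (outer_norm D) + 1), (fine (outer_norm D) + 2); rewrite ltry;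
      split=> //; lra.
  have k'0 : 0 < k' by apply: le_lt_trans lt_k'; exact: fine_ge0.
  have nlip V W : nbhs xbar V -> nbhs ubar W -> ~ lip_inclusion S X V W k.
    move=> Vx Wu lip; move: lt_k; rewrite ltNge => /negP; apply.
    apply: ereal_inf_lbound; exists k => //; split; last by exists V, W.
    by rewrite ltW// (lt_trans k'0).
  have [k1|us [xs [Dxs xsk us1]]] :=
      @proj_coderivative_of_normals _ _ _ S X xbar ubar k' 1 1 _ (cvg_cst (1 : R))
        (fun=> lexx (1 : R)).
    by apply: regular_normal_of_failure nlip => //; rewrite ?mul1r// invr_gt0.
  have := le_outer_norm us1 Dxs; rewrite xsk -(fineK fin) lee_fin.
  by rewrite leNgt lt_k'.
have ab : lipschitz_like S X xbar ubar -> D 0 = [set 0].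
  move=> [_ [V [W [k [Vx Wu k0 lip]]]]].
  apply/seteqP; split => [xs Dxs|_ ->//] /=.
  have := proj_coderivative_bound X_convex lip k0 Vx Wu Dxs.
  rewrite enorm0 mulr0 => xs0; apply/eqP.
  by rewrite -enorm_eq0 eq_le xs0 enorm_ge0.
have ca : (outer_norm D < +oo)%E -> lipschitz_like S X xbar ubar.
  rewrite -lip_eq => /ereal_inf_lt[_ [k [k0 [V [W [Vx Wu lip]]]] <-] _].
  by split => //; exists V, W, k.
have ac : lipschitz_like S X xbar ubar -> (outer_norm D < +oo)%E.
  move=> [_ [V [W [k [Vx Wu k0 lip]]]]]; apply: le_lt_trans (ltry k).
  by apply: outer_norm_le => // us xs;
    exact: proj_coderivative_bound lip k0 Vx Wu.
have ba : D 0 = [set 0] -> lipschitz_like S X xbar ubar.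
  move=> D0; apply: contrapT => nlip.
  (* At stage k the inclusion fails with constant k + 1, and the factor 2 makes
     1 < (2 / (k + 1)) (k + 1). *)
  have h0 : (2 * k.+1%:R^-1 : R) @[k --> \oo] --> (0 : R).
    by rewrite -(mulr0 2); apply: cvgMr; exact: cvg_harmonic.
  have hB k : 2 * k.+1%:R^-1 <= 2 :> R.
    by rewrite ger_pMr// invf_le1 ?ltr0n// ler1n.
  have [k|us [xs [Dxs xs1 us0]]] :=
      @proj_coderivative_of_normals _ _ _ S X xbar ubar 1 _ _ _ h0 hB.
    apply: (@regular_normal_of_failure _ _ _ _ _ _ _ _ _ k.+1%:R) => //.
    - by rewrite mulfVK ?pnatr_eq0// ltr1n.
    - by move=> V W Vx Wu lip; apply: nlip; split => //; exists V, W, k.+1%:R.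
  have us00 : us = 0 by apply/eqP; rewrite -enorm_eq0 eq_le us0 enorm_ge0.
  move: Dxs; rewrite us00 -/D D0 /= => xs0.
  by move: xs1; rewrite xs0 enorm0 => /esym/eqP; rewrite oner_eq0.
by split => //; split => // [/ba/ac|/ca/ab].
Qed.
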